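(* Given integers $n,k\ge 1$ and subsets $C_1,\dots,C_n\subseteq[k]$, let $R_i=\{j\in[n] : i\in C_j\}$ for $i\in[k]$. Then the quantity $$d_{\max} = 1+\min_{\varnothing\ne I\subseteq[k]}\Big\{\Big|\bigcup_{i\in I}R_i\Big|-|I|\Big\}$$ can be computed in polynomial time.
   Context: $[n]=\{1,\dots,n\}$. Polynomial time means that there is an algorithm which, on input the sets $C_1,\dots,C_n$, outputs $d_{\max}$ in a number of steps bounded by a polynomial in $n$ and $k$. (The quantity $d_{\max}$ is an upper bound on the minimum distance of a linear code encoding $x\in\mathbb{F}_q^k$ into $c\in\mathbb{F}_q^n$ in which each coded symbol $c_j$ is a function only of the data symbols indexed by $C_j$.) *)

(* Defs.v *)
From mathcomp Require Import all_boot all_order all_algebra.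

Set Implicit Arguments.
Unset Strict Implicit.
Unset Printing Implicit Defensive.

Import Order.TTheory GRing.Theory Num.Theory.
Local Open Scope ring_scope.

(* [n] and [k] are represented by 'I_n and 'I_k, so indices start at 0. *)

Definition Rset (n k : nat) (C : 'I_n -> {set 'I_k}) (i : 'I_k) : {set 'I_n} :=
  [set j | i \in C j].

Definition excess (n k : nat) (C : 'I_n -> {set 'I_k}) (I : {set 'I_k}) : int :=
  #|\bigcup_(i in I) Rset C i|%:Z - #|I|%:Z.

(* The default argument [set: 'I_k] of the arg min is nonempty, and the arg min
   is a true minimizer, as soon as 0 < k.  The value may be negative. *)
Definition dmax (n k : nat) (C : 'I_n -> {set 'I_k}) : int :=
  1 + excess C [arg min_(I < [set: 'I_k] | I != set0) excess C I]%O.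

(* The computation model is the random access machine of Cook and Reckhow,
   with unit cost.  The only arithmetic instructions are addition and
   subtraction, so a step lengthens the largest register content by at most
   one bit, and polynomial time on this machine is polynomial time on a Turing
   machine.  Registers are indexed by int rather than nat only so that every
   register content is a valid address for indirect access. *)

Definition memory := int -> int.

Inductive instr :=
| IConst (d c : int)        (* X_d <- c *)
| IAdd (d a b : int)        (* X_d <- X_a + X_b *)
| ISub (d a b : int)        (* X_d <- X_a - X_b *)
| IFetch (d a : int)        (* X_d <- X_(X_a) *)
| IStore (d a : int)        (* X_(X_d) <- X_a *)
| IJump (a : int) (l : nat) (* if 0 < X_a then go to instruction l *).

Definition upd (m : memory) (d v : int) : memory :=
  fun a => if a == d then v else m a.

Definition config := (nat * memory)%type.

Definition exec (i : instr) (s : config) : config :=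
  let: (pc, m) := s in
  match i with
  | IConst d c => (pc.+1, upd m d c)
  | IAdd d a b => (pc.+1, upd m d (m a + m b))
  | ISub d a b => (pc.+1, upd m d (m a - m b))
  | IFetch d a => (pc.+1, upd m d (m (m a)))
  | IStore d a => (pc.+1, upd m (m d) (m a))
  | IJump a l => (if 0 < m a then l else pc.+1, m)
  end.

(* The machine halts when the program counter leaves the program; a halted
   configuration is a fixed point of step. *)
Definition step (P : seq instr) (s : config) : config :=
  if onth P s.1 is Some i then exec i s else s.

Definition run (P : seq instr) (m : memory) (t : nat) : config :=
  iter t (step P) (0%N, m).

(* From initial memory m, P halts after at most t steps with v in X_0. *)
Definition outputs_within (P : seq instr) (m : memory) (t : nat) (v : int) :=
  (size P <= (run P m t).1)%N /\ (run P m t).2 0 = v.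

(* X_0 = n, X_1 = k, and X_(2 + (j * k + i)) is 1 if i \in C j and 0 otherwise;
   all other registers are 0. *)
Definition input (n k : nat) (C : 'I_n -> {set 'I_k}) : memory := fun a =>
  match a with
  | Posz 0 => n%:Z
  | Posz 1 => k%:Z
  | Posz b.+2 =>
      [exists j : 'I_n, exists i : 'I_k,
         (b == j * k + i)%N && (i \in C j)]%:Z
  | Negz _ => 0
  end.

(* Main.v *)
Require Import Defs.
From mathcomp Require Import all_boot all_order all_algebra.
From mathcomp Require Import zify.

(* For a data symbol i0, the sets I containing i0 satisfy
     min (|U_(i in I) R_i| - |I|) = |R_i0| + nu - k,
   where nu is the size of a maximum matching between data symbols and the coded
   symbols outside R_i0.  The matching is found by an auction: every coded symbol
   has a price, starting at n+1 in R_i0 and at 0 elsewhere; a waiting data symbol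
   takes over the cheapest coded symbol it occurs in, evicts the owner and raises
   the price by 1, or gives up when that price is n+1.  Prices only grow, hence
   polynomial time.  In the end |R_i0| + nu is the number of coded symbols with a
   positive price, and some price level in 1..n+1 is unused, which cuts out an
   optimal I.  The minimum over i0 gives d_max. *)

Set Implicit Arguments.
Unset Strict Implicit.
Unset Printing Implicit Defensive.

Import Order.TTheory GRing.Theory Num.Theory.
Local Open Scope ring_scope.

(** * A structured command language compiled to the machine *)

(* The programs keep 1 in this register, so that IJump rone is unconditional. *)
Notation rone := (Negz 0).

(* For r c runs c with X_r equal to v-1, ..., 1, 0, where v is the initial value
   of X_r. *)
Inductive cmd :=
| Instr (i : instr)
| Seq (c1 c2 : cmd)
| When (a : int) (c : cmd)
| For (r : int) (c : cmd).

Fixpoint csize (c : cmd) : nat :=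
  match c with
  | Instr _ => 1
  | Seq c1 c2 => csize c1 + csize c2
  | When _ c => (csize c).+2
  | For _ c => (csize c).+4
  end%N.

(** Jump targets are absolute, so [off] is the address of the first instruction. As jumps are taken
    on positive values only, a successful test jumps over an unconditional jump to the exit. *)
Fixpoint compile (c : cmd) (off : nat) : seq instr :=
  match c with
  | Instr i => [:: i]
  | Seq c1 c2 => compile c1 off ++ compile c2 (off + csize c1)%N
  | When a c =>
      [:: IJump a off.+2, IJump rone (off.+2 + csize c)%N & compile c off.+2]
  | For r c =>
      [:: IJump r off.+2, IJump rone (off.+4 + csize c)%N, ISub r r rone
        & rcons (compile c off.+3) (IJump rone off)]
  end.

(* B bounds the number of iterations of every loop.  The semiring is a parameter
   so that the same recursion yields the time bound as a number and as a
   polynomial. *)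
Fixpoint cost (R : pzSemiRingType) (B : R) (c : cmd) : R :=
  match c with
  | Instr _ => 1
  | Seq c1 c2 => cost B c1 + cost B c2
  | When _ c => 2%:R + cost B c
  | For _ c => B * (3%:R + cost B c) + 2%:R
  end.

(** Evaluation commutes with sums, products and constants, so a polynomial time bound specializes to
    the numeric one; applied once per variable. *)
Lemma horner_cost (R : comNzSemiRingType) (B : {poly R}) (c : cmd) (x : R) :
  (cost B c).[x] = cost B.[x] c.
Proof.
have hornerN n : (n%:R : {poly R}).[x] = n%:R.
  by elim: n => [|n IHn]; rewrite ?horner0 // !mulrS hornerD IHn -polyC1 hornerC.
elim: c => [i|c1 IH1 c2 IH2|a c IH|r c IH] /=.
- by rewrite -polyC1 hornerC.
- by rewrite hornerD IH1 IH2.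
- by rewrite hornerD IH hornerN.
- by rewrite hornerD hornerM hornerD IH !hornerN.
Qed.

Lemma size_compile (c : cmd) (off : nat) : size (compile c off) = csize c.
Proof.
elim: c off => [i|c1 IH1 c2 IH2|a c IH|r c IH] off //=.
- by rewrite size_cat IH1 IH2.
- by rewrite IH.
- by rewrite size_rcons IH.
Qed.

Definition code_at (P : seq instr) (off : nat) (s : seq instr) :=
  exists p1 p2, P = p1 ++ s ++ p2 /\ size p1 = off.

Lemma code_at_catl P off s1 s2 : code_at P off (s1 ++ s2) -> code_at P off s1.
Proof. by move=> [p1 [p2 [-> <-]]]; exists p1, (s2 ++ p2); rewrite -catA. Qed.

Lemma code_at_catr P off s1 s2 :
  code_at P off (s1 ++ s2) -> code_at P (off + size s1) s2.
Proof.
move=> [p1 [p2 [-> <-]]]; exists (p1 ++ s1), p2.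
by rewrite size_cat -!catA.
Qed.

Lemma code_at_behead P off i s : code_at P off (i :: s) -> code_at P off.+1 s.
Proof. by rewrite -cat1s => /code_at_catr; rewrite addn1. Qed.

Lemma step_code_at P off i s m :
  code_at P off (i :: s) -> step P (off, m) = exec i (off, m).
Proof.
by move=> [p1 [p2 [-> <-]]]; rewrite /step /= onth_cat ltnn subnn.
Qed.

(** * Hoare rules for total correctness within a time bound *)

Definition wp (B : nat) (c : cmd) (m : memory) (Q : memory -> Prop) :=
  forall P off, code_at P off (compile c off) ->
  exists t m', [/\ (t <= cost B c)%N,
    iter t (step P) (off, m) = ((off + csize c)%N, m') & Q m'].

Section Rules.
Variable B : nat.

Lemma wp_mono c m (Q Q' : memory -> Prop) :
  (forall m', Q m' -> Q' m') -> wp B c m Q -> wp B c m Q'.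
Proof.
move=> QQ' w P off /w [t [m' [le_t run_t Qm']]].
by exists t, m'; split=> //; apply: QQ'.
Qed.

Definition is_jump i := if i is IJump _ _ then true else false.

Lemma wp_instr i m (Q : memory -> Prop) :
  ~~ is_jump i -> Q (exec i (0%N, m)).2 -> wp B (Instr i) m Q.
Proof.
move=> nj Qm P off /= /(step_code_at m) st.
exists 1%N, (exec i (0%N, m)).2; split=> //=.
by rewrite st addn1; case: i nj {st Qm}.
Qed.

Lemma wp_seq c1 c2 m Q :
  wp B c1 m (fun m' => wp B c2 m' Q) -> wp B (Seq c1 c2) m Q.
Proof.
move=> w1 P off /= emb.
have [t1 [m1 [le1 run1 /(_ P (off + csize c1)%N)]]] := w1 _ _ (code_at_catl emb).
case=> [|t2 [m2 [le2 run2 Q2]]].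
  by rewrite -(size_compile c1 off); apply: code_at_catr; rewrite size_compile.
exists (t2 + t1)%N, m2; split=> //; first by rewrite addnC leq_add.
by rewrite iterD run1 run2 addnA.
Qed.

Lemma wp_when a c m (Q : memory -> Prop) :
  m rone = 1 -> (0 < m a -> wp B c m Q) -> (m a <= 0 -> Q m) ->
  wp B (When a c) m Q.
Proof.
move=> one1 wt wf P off /= emb.
have emb1 := code_at_behead emb; have emb2 := code_at_behead emb1.
case: (ltP 0 (m a)) => a_gt0.
  have [t [m' [le_t run_t Qm']]] := wt a_gt0 _ _ emb2.
  exists t.+1, m'; split=> //.
    exact: (@leq_trans (1 + cost B c)%N).
  rewrite iterSr (step_code_at _ emb) /= a_gt0 run_t.
  by rewrite !addSn !addnS.
exists 2%N, m; split; [by [] | | exact: wf].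
rewrite /= (step_code_at _ emb) /= ltNge a_gt0 /= (step_code_at _ emb1) /= one1.
by rewrite /= !addSn !addnS.
Qed.

(** [J i] is the invariant with [i] iterations left. The body starts after the decrement and must
    leave the counter as it found it. *)
Lemma wp_for (J : nat -> memory -> Prop) r c N m (Q : memory -> Prop) :
  (N <= B)%N -> m r = N%:Z -> J N m ->
  (forall i m, J i m -> m rone = 1) ->
  (forall i m, (i < N)%N -> m r = i.+1%:Z -> J i.+1 m ->
     wp B c (upd m r i%:Z) (fun m' => m' r = i%:Z /\ J i m')) ->
  (forall m, m r = 0 -> J 0%N m -> Q m) ->
  wp B (For r c) m Q.
Proof.
move=> leNB mr JN Jone body fin P off /= emb.
have emb1 := code_at_behead emb; have emb2 := code_at_behead emb1.
have := code_at_behead emb2; rewrite -cats1 => emb34.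
have emb3 := code_at_catl emb34; have emb4 := code_at_catr emb34.
rewrite size_compile in emb4.
suff loop : forall i m, (i <= N)%N -> m r = i%:Z -> J i m ->
    exists t m', [/\ (t <= i * (3 + cost B c) + 2)%N,
      iter t (step P) (off, m) = ((off + (csize c).+4)%N, m') & Q m'].
  have [t [m' [le_t run_t Qm']]] := loop N m (leqnn N) mr JN.
  exists t, m'; split=> //; apply: (leq_trans le_t).
  by apply: leq_add => //; rewrite leq_mul2r leNB orbT.
elim=> [|i IHi] {m mr JN}m leiN mr Jm.
  exists 2%N, m; split=> //; last exact: fin.
  rewrite /= (step_code_at _ emb) /= mr /= (step_code_at _ emb1) /= (Jone _ _ Jm).
  by rewrite /= !addSn !addnS.
have [t [m1 [le1 run1 [m1r Jm1]]]] := body i m leiN mr Jm _ _ emb3.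
have [t2 [m2 [le2 run2 Q2]]] := IHi m1 (ltnW leiN) m1r Jm1.
(* Two steps for the test and the decrement, [t] for the body, one for the jump back, [t2] for the
   remaining iterations. *)
exists (t2 + (1 + (t + 2)))%N, m2; split=> //.
  rewrite mulSn; move: le1 le2 => /=; set x := cost _ _; lia.
rewrite !iterD [iter 2 _ _]/= (step_code_at _ emb) /= mr /= (step_code_at _ emb2) /=.
rewrite mr (Jone _ _ Jm).
have -> : i.+1%:Z - 1 = i%:Z by lia.
rewrite run1 (step_code_at _ emb4) /= (Jone _ _ Jm1) /=.
exact: run2.
Qed.

End Rules.

Lemma outputs_within_wp (B : nat) (c : cmd) (m : memory) (v : int) :
  wp B c m (fun m' => m' 0 = v) ->
  outputs_within (compile c 0) m (cost B c) v.
Proof.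
case/(_ (compile c 0) 0%N) => [|t [m' [le_t run_t m'0]]].
  by exists [::], [::]; rewrite cats0.
(* The run may end before the bound; a halted configuration is fixed, so it persists through the
   remaining steps. *)
have halted s : step (compile c 0) (csize c, s) = (csize c, s).
  by rewrite /step /= -{2}(size_compile c 0) onth_default ?size_compile.
have runE : run (compile c 0) m (cost B c) = (csize c, m').
  rewrite /run -(subnK le_t) iterD run_t add0n.
  by elim: (_ - _)%N => //= d ->.
by rewrite /outputs_within runE size_compile.
Qed.

(** * The auction and its invariant *)

Section Auction.
Variables (n k : nat) (C : 'I_n -> {set 'I_k}).
Local Open Scope nat_scope.

(* p and o are the prices and owners of the coded symbols.  The data symbols i
   with d <= i have entered the auction; cur is the one waiting to bid. *)
Record auction_inv (i0 : 'I_k) (d : nat) (p : 'I_n -> nat)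
    (o : 'I_n -> option 'I_k) (cur : option 'I_k) : Prop := AuctionInv {
  inv_closed : forall j, i0 \in C j -> p j = n.+1 /\ o j = None;
  inv_open : forall j, i0 \notin C j -> p j <= n.+1 /\ (o j == None) = (p j == 0);
  inv_owner : forall j i, o j = Some i ->
    [/\ d <= i, i \in C j & forall j', i \in C j' -> p j <= (p j').+1];
  inv_inj : forall j j' i, o j = Some i -> o j' = Some i -> j = j';
  inv_cur : forall i, cur = Some i -> d <= i /\ forall j, o j <> Some i;
  inv_dropped : forall i : 'I_k, d <= i -> cur <> Some i ->
    (forall j, o j <> Some i) -> forall j, i \in C j -> n < p j }.

Definition fupd (T : Type) (f : 'I_n -> T) (j : 'I_n) (v : T) : 'I_n -> T :=
  fun j' => if j' == j then v else f j'.

Lemma auction_init (i0 : 'I_k) (p : 'I_n -> nat) (o : 'I_n -> option 'I_k) :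
  (forall j, p j = if i0 \in C j then n.+1 else 0) -> (forall j, o j = None) ->
  auction_inv i0 k p o None.
Proof.
move=> pE oE; split=> //.
- by move=> j i0j; rewrite pE i0j.
- by move=> j /negPf i0j; rewrite pE i0j oE.
- by move=> j i; rewrite oE.
- by move=> j j' i; rewrite oE.
- by move=> i; rewrite leqNgt ltn_ord.
Qed.

Lemma auction_enter (i0 i : 'I_k) (p : 'I_n -> nat) (o : 'I_n -> option 'I_k) :
  auction_inv i0 i.+1 p o None -> auction_inv i0 i p o (Some i).
Proof.
case=> cl op ow inj _ dr; split=> //.
- by move=> j i' /ow[/ltnW].
- by move=> i' [<-]; split=> // j /ow[]; rewrite ltnn.
- move=> i' le_ii' ne_i'; apply: dr => //.
  rewrite ltn_neqAle le_ii' andbT; apply/eqP => /val_inj ii'.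
  by apply: ne_i'; rewrite ii'.
Qed.

Lemma auction_drop (i0 i : 'I_k) (d : nat) (p : 'I_n -> nat)
    (o : 'I_n -> option 'I_k) :
  auction_inv i0 d p o (Some i) -> (forall j, i \in C j -> n < p j) ->
  auction_inv i0 d p o None.
Proof.
case=> cl op ow inj cu dr pi; split=> //.
move=> i' le_di' _ free_i'; have [->//|ne] := eqVneq i' i.
by apply: dr => // -[ii']; rewrite ii' eqxx in ne.
Qed.

(** Since [j] is cheapest for [i], its raised price exceeds no price available to [i] by more than
    1. For other owners only the right-hand sides of these inequalities can grow. The bound
    [p j <= n] keeps [j] out of the symbols containing [i0], which cost [n.+1]. *)
Lemma auction_bid (i0 i : 'I_k) (d : nat) (p : 'I_n -> nat)
    (o : 'I_n -> option 'I_k) (j : 'I_n) :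
  auction_inv i0 d p o (Some i) -> i \in C j -> p j <= n ->
  (forall j', i \in C j' -> p j <= p j') ->
  auction_inv i0 d (fupd p j (p j).+1) (fupd o j (Some i)) (o j).
Proof.
case=> cl op ow inj cu dr ij pj min_j.
have [le_di free_i] := cu i erefl.
have le_p j' : p j' <= fupd p j (p j).+1 j'.
  by rewrite /fupd; case: eqP => [->|].
split.
- move=> j' /cl[pj' oj']; rewrite /fupd; case: eqP pj' => [->|//] pj'.
  by rewrite pj' ltnn in pj.
- by move=> j' /op; rewrite /fupd; case: (j' =P j).
- move=> j' i'; rewrite /fupd; case: eqP => [-> [<-]|_ /ow[? ? le_j']].
    split=> // j1 ij1; rewrite ltnS; apply: leq_trans (le_p _); exact: min_j.
  by split=> // j1 /le_j' /leq_trans-> //; rewrite ltnS; exact: le_p.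
- move=> j1 j2 i'; rewrite /fupd.
  case: eqP => [-> [<-]|_ o1]; case: eqP => [->|_ o2] //.
  + by case: (free_i _ o2).
  + by move=> [ii']; case: (free_i j1); rewrite ii'.
  + exact: inj o1 o2.
- move=> i' oj; split=> [|j']; first by have [] := ow _ _ oj.
  rewrite /fupd; case: eqP => [_ [ii']|ne o']; first by apply: (free_i j); rewrite ii'.
  by apply: ne; exact: inj o' oj.
- move=> i' le_di' oj free_i' j' i'j'.
  have free j1 : o j1 <> Some i'.
    have [->//|/negPf ne] := eqVneq j1 j.
    by move: (free_i' j1); rewrite /fupd ne.
  apply: leq_trans (le_p _); apply: dr (i'j') => // -[ii'].
  by apply: (free_i' j); rewrite /fupd eqxx ii'.
Qed.

Lemma sum_fupd_succ (p : 'I_n -> nat) (j : 'I_n) :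
  \sum_j' fupd p j (p j).+1 j' = (\sum_j' p j').+1.
Proof.
rewrite (bigD1 j) //= [in RHS](bigD1 j) //= /fupd eqxx addSn; congr (_ + _).+1.
by apply: eq_bigr => j' /negPf->.
Qed.

Lemma auction_sum_le (i0 : 'I_k) d p o cur :
  auction_inv i0 d p o cur -> \sum_j p j <= n * n.+1.
Proof.
have <- : \sum_(j < n) n.+1 = n * n.+1 by rewrite sum_nat_const card_ord.
case=> cl op _ _ _ _.
apply: leq_sum => j _.
by case: (boolP (i0 \in C j)) => [/cl[->]|/op[]].
Qed.

(** * Duality between prices and excess *)

Lemma price_gap (p : 'I_n -> nat) :
  exists l, 0 < l <= n.+1 /\ forall j, p j <> l.
Proof.
have [/hasP[l]|/hasPn full] := boolP (has [pred l | l \notin codom p] (iota 1 n.+1)).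
  rewrite mem_iota => l_in /= l_gap; exists l; split; first lia.
  by move=> j pj; case/negP: l_gap; rewrite -pj codom_f.
(* Pigeonhole: [n] symbols cannot occupy all [n.+1] levels. *)
suff : size (iota 1 n.+1) <= size (codom p).
  by rewrite size_iota size_codom card_ord ltnn.
by apply: uniq_leq_size (iota_uniq _ _) _ => l /full; rewrite negbK.
Qed.

(** Weak duality, valid at any stage of the auction: a symbol with positive price that meets no
    member of [I] is owned, and by someone outside [I]. Owners of distinct symbols are distinct, so
    there are at most [k - #|I|] such symbols. *)
Lemma excess_lower (i0 : 'I_k) p o cur d (I : {set 'I_k}) :
  auction_inv i0 d p o cur -> i0 \in I ->
  (#|[set j | (0 < p j)%N]|%:Z - k%:Z <= excess C I)%R.
Proof.
case=> cl op ow inj _ _ i0I; rewrite /excess.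
set P := [set j | _]; set N := \bigcup_(i in I) _.
have owned j : j \in P :\: N -> exists2 i, o j = Some i & i \notin I.
  rewrite !inE => /andP[jN pj].
  have i0j : i0 \notin C j.
    by apply: contra jN => i0j; apply/bigcupP; exists i0; rewrite ?inE.
  have [_] := op _ i0j; rewrite (gtn_eqF pj).
  case oj: (o j) => [i|] // _; exists i => //.
  have [_ ij _] := ow _ _ oj.
  by apply: contra jN => iI; apply/bigcupP; exists i; rewrite ?inE.
have : #|P :\: N| <= #|~: I|.
  rewrite -(card_in_imset (f := o) (D := P :\: N)); last first.
    by move=> j j' /owned[i oj _] _ jj'; apply: (inj _ _ i oj); rewrite -jj'.
  rewrite -(card_imset (~: I) (@Some_inj _)); apply: subset_leq_card.
  apply/subsetP => _ /imsetP[j /owned[i oj iI] ->].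
  by rewrite oj imset_f // inE.
have := cardsC I; rewrite card_ord.
have := subset_leq_card (subsetIr P N).
have := cardsID N P.
move: #|P| #|P :&: N| #|P :\: N| #|N| #|I| #|~: I| => *; lia.
Qed.

(* Since no price equals l, the owners of the symbols priced above l and the
   unmatched data symbols have all their symbols priced at least l. *)
Lemma excess_upper (i0 : 'I_k) p o :
  auction_inv i0 0 p o None ->
  exists2 I : {set 'I_k}, i0 \in I &
    (excess C I <= #|[set j | (0 < p j)%N]|%:Z - k%:Z)%R.
Proof.
case=> cl op ow inj _ dr.
have [l [/andP[l_gt0 l_le] gap]] := price_gap p.
pose I := [set i : 'I_k | [forall j, (o j == Some i) ==> (l <= p j)]].
exists I.
  (* [i0] owns nothing, because its symbols have no owner. *)
  rewrite inE; apply/forallP => j; apply/implyP => /eqP oj.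
  by have [_ /cl[_]] := ow _ _ oj; rewrite oj.
rewrite /excess; set P := [set j | _]; set N := \bigcup_(i in I) _.
pose T := [set j | l <= p j].
(* If [i] owns [j1], then [p j1] is above [l] by the gap, and the other symbols of [i] are at most 1
   cheaper. If [i] owns nothing it has given up, and all its symbols cost more than [n]. *)
have NT : N \subset T.
  apply/subsetP => j /bigcupP[i]; rewrite !inE => /forallP iI ij.
  have [/existsP[j1 /eqP oj1]|/existsPn free] := boolP [exists j1, o j1 == Some i].
    have := iI j1; rewrite oj1 eqxx /= => lp1; have := gap j1.
    by have [_ _ /(_ _ ij)] := ow _ _ oj1; lia.
  apply: leq_trans l_le _; apply: dr ij => // j1 /eqP oj1.
  by have := free j1; rewrite oj1.
have TP : T \subset P by apply/subsetP => j; rewrite !inE; lia.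
(* Everyone outside [I] owns a symbol with positive price below [l], so the owner map on [P :\: T]
   covers the complement of [I]. *)
have : #|~: I| <= #|P :\: T|.
  rewrite -(card_imset (~: I) (@Some_inj _)).
  apply: leq_trans (leq_imset_card o (P :\: T)); apply: subset_leq_card.
  apply/subsetP => _ /imsetP[i + ->]; rewrite !inE => /forallPn[j].
  rewrite negb_imply -ltnNge => /andP[/eqP oj pj].
  rewrite -oj imset_f // !inE -ltnNge pj /=.
  have [_ ij _] := ow _ _ oj.
  case: (boolP (i0 \in C j)) => [/cl[_]|/op[_]]; rewrite oj //=.
  by move=> /esym/negbT; rewrite lt0n.
have := cardsC I; rewrite card_ord.
rewrite cardsD (setIidPr TP).
have := subset_leq_card NT; have := subset_leq_card TP.
move: #|P| #|T| #|N| #|I| #|~: I| => *; lia.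
Qed.

End Auction.

Lemma dmax_eq (n k : nat) (C : 'I_n -> {set 'I_k}) (v : int) :
  (exists2 I, I != set0 & excess C I <= v) ->
  (forall I, I != set0 -> v <= excess C I) -> dmax C = 1 + v.
Proof.
move=> [I I_neq0 le_Iv] le_v; rewrite /dmax; congr (1 + _).
case: arg_minP => [|I' I'_neq0 min_I'].
  (* The default of the arg min is admissible, as it contains the nonempty [I]. *)
  by apply: contraNneq I_neq0 => T0; rewrite -subset0 -T0 subsetT.
apply/eqP; rewrite eq_le le_v // andbT; apply: le_trans le_Iv; exact: min_I'.
Qed.

(** * The program *)

Coercion Instr : instr >-> cmd.
Notation "c1 ;; c2" := (Seq c1 c2) (at level 61, right associativity).

(* Scalars live at the addresses -1, ..., -18, the price of the coded symbol j at
   -20 - j, and its owner, encoded as 0 for none and i+1 for i, at 2 + n*k + j,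
   just after the input. *)
Notation rzero := (Negz 1).
Notation rbase := (Negz 2).
Notation rcap := (Negz 3).
Notation rown := (Negz 4).
Notation rres := (Negz 5).
Notation ri0 := (Negz 6).
Notation ri := (Negz 7).
Notation rc1 := (Negz 8).
Notation rc2 := (Negz 9).
Notation rcur := (Negz 10).
Notation rj := (Negz 11).
Notation radr := (Negz 12).
Notation rbp := (Negz 13).
Notation rbj := (Negz 14).
Notation rt1 := (Negz 15).
Notation rt2 := (Negz 16).
Notation rcnt := (Negz 17).

(** Cheapest symbol for the bidder, with the price capped at [n.+1]. [radr] walks backwards through
    the column of membership bits, from just past the last row, in strides of [k]. *)
Definition scan : cmd :=
  IAdd rbp rcap rzero ;; IAdd rj 0 rzero ;;
  IAdd radr rown rcur ;; ISub radr radr rone ;;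
  For rj (
    ISub radr radr 1 ;; IFetch rt1 radr ;;
    When rt1 (
      ISub rt1 rbase rj ;; IFetch rt1 rt1 ;; ISub rt2 rbp rt1 ;;
      When rt2 (IAdd rbp rt1 rzero ;; IAdd rbj rj rzero))).

(** [rcur] uses the owner encoding, so 0 means that nobody waits and the command does nothing. It is
    cleared before the price test: a bidder who meets the cap is thereby dropped; otherwise the
    evicted owner, if any, is loaded into it. *)
Definition bid : cmd :=
  When rcur (
    scan ;; IAdd rcnt rcur rzero ;; IAdd rcur rzero rzero ;;
    ISub rt2 rcap rbp ;;
    When rt2 (
      ISub rt1 rbase rbj ;; IAdd rt2 rbp rone ;; IStore rt1 rt2 ;;
      IAdd rt1 rown rbj ;; IFetch rcur rt1 ;; IStore rt1 rcnt)).

(** The two nested loops give [n.+1 * n.+1] bids without multiplication. *)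
Definition auction : cmd :=
  IAdd ri 1 rzero ;;
  For ri (
    IAdd rcur ri rone ;; IAdd rc1 rcap rzero ;;
    For rc1 (IAdd rc2 rcap rzero ;; For rc2 bid)).

Definition reset : cmd :=
  IAdd rj 0 rzero ;; IAdd radr rown ri0 ;;
  For rj (
    ISub radr radr 1 ;; ISub rt1 rbase rj ;; IStore rt1 rzero ;;
    IFetch rt2 radr ;; When rt2 (IStore rt1 rcap) ;;
    IAdd rt1 rown rj ;; IStore rt1 rzero).

Definition tally : cmd :=
  IAdd rcnt rzero rzero ;; IAdd rj 0 rzero ;;
  For rj (
    ISub rt1 rbase rj ;; IFetch rt1 rt1 ;;
    When rt1 (IAdd rcnt rcnt rone)).

Definition setup : cmd :=
  IConst rone 1 ;; IConst rzero 0 ;; IConst rbase (Negz 19) ;;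
  IAdd rcap 0 rone ;; IConst rown 2 ;; IAdd rj 0 rzero ;;
  For rj (IAdd rown rown 1).

(** [rres] keeps the least tally so far, starting from [n], which no tally exceeds. *)
Definition dmax_prog : cmd :=
  setup ;; IAdd rres 0 rzero ;; IAdd ri0 1 rzero ;;
  For ri0 (
    reset ;; auction ;; tally ;; ISub rt1 rres rcnt ;;
    When rt1 (IAdd rres rcnt rzero)) ;;
  IAdd 0 rres rone ;; ISub 0 0 1.

(** * Verification of the program *)

Lemma upd_eq m a v : upd m a v a = v.
Proof. by rewrite /upd eqxx. Qed.

Lemma upd_neq m a b v : (a == b) = false -> upd m b v a = m a.
Proof. by rewrite /upd => ->. Qed.

(** The addresses reserved for scalars that vary after [setup]. The five constants, the input, the
    prices and the owners are excluded; [base] and [state] track those. *)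
Definition scratch (a : int) : bool :=
  if a is Negz b then (4 < b < 19)%N else false.

Definition frame (W : seq int) (m m' : memory) :=
  forall a, scratch a -> a \notin W -> m' a = m a.

Lemma frame_upd W m m' a v :
  ~~ scratch a || (a \in W) -> frame W m m' -> frame W m (upd m' a v).
Proof.
move=> aW fr b sb bW; rewrite upd_neq ?fr //.
by apply: contraNF bW => /eqP ba; move: aW; rewrite -ba sb.
Qed.

Lemma frame_trans W W' m1 m2 m3 :
  all (mem W) W' -> frame W m1 m2 -> frame W' m2 m3 -> frame W m1 m3.
Proof.
move=> /allP sW f12 f23 a sa aW; rewrite f23 ?f12 //.
by apply: contra aW; exact: sW.
Qed.

Ltac instr := first [apply: wp_seq; apply: wp_instr => // |apply: wp_instr => //];
  rewrite [(exec _ _).2]/=.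
Ltac upds := repeat first [rewrite upd_eq | rewrite upd_neq; [|by []]].

Section Program.
Variables (n k : nat) (C : 'I_n -> {set 'I_k}) (B : nat).
Hypotheses (leNB : (n < B)%N) (lekB : (k <= B)%N).

Record base (m : memory) : Prop := Base {
  base_n : m 0 = n; base_k : m 1 = k;
  base_one : m rone = 1; base_zero : m rzero = 0;
  base_base : m rbase = Negz 19; base_cap : m rcap = n.+1;
  base_own : m rown = (2 + n * k)%N;
  base_bit : forall (j : 'I_n) (i : 'I_k), m (2 + (j * k + i))%N = (i \in C j) }.

Definition unfixed (a : int) : bool :=
  match a with Posz b => 2 + n * k <= b | Negz b => 4 < b end%N.

Lemma bit_lt (j : 'I_n) (i : 'I_k) : (j * k + i < n * k)%N.
Proof.
apply: (@leq_trans (j.+1 * k)); first by rewrite mulSn addnC ltn_add2r.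
by rewrite leq_mul2r ltn_ord orbT.
Qed.

Lemma base_upd m a v : unfixed a -> base m -> base (upd m a v).
Proof.
move=> ua [? ? ? ? ? ? ? bit]; have neq b : ~~ unfixed b -> (b == a) = false.
  by move=> ub; apply: contraNF ub => /eqP->.
split; rewrite ?upd_neq ?neq //= -?ltnNge; try lia.
by move=> j i; rewrite upd_neq ?neq //= -ltnNge ltn_add2l bit_lt.
Qed.

Lemma scratch_unfixed a : scratch a -> unfixed a.
Proof. by case: a => //= b /andP[]. Qed.

Definition enc (o : option 'I_k) : int := if o is Some i then i.+1%:Z else 0.

Record state (p : 'I_n -> nat) (o : 'I_n -> option 'I_k) (m : memory) : Prop :=
  State {
  state_base : base m;
  state_price : forall j : 'I_n, m (Negz (19 + j)) = p j;
  state_owner : forall j : 'I_n, m (2 + n * k + j)%N = enc (o j) }.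

Lemma state_upd p o m a v : scratch a -> state p o m -> state p o (upd m a v).
Proof.
move=> sa [bm pm om]; split=> [|j|j].
- by apply: base_upd => //; apply: scratch_unfixed.
- rewrite upd_neq //; case: a sa => //= b /andP[_ b19]; apply/eqP => -[]; lia.
- by rewrite upd_neq //; case: a sa.
Qed.

Lemma Negz_base (j : nat) : Negz 19 - j%:Z = Negz (19 + j).
Proof. by rewrite !NegzE; lia. Qed.

Lemma wp_setup : wp B setup (input C) base.
Proof.
rewrite /setup; do 6 instr.
set m0 := upd _ _ _.
have m0n : m0 0 = n by rewrite /m0; upds.
have m0k : m0 1 = k by rewrite /m0; upds.
have m01 : m0 rone = 1 by rewrite /m0; upds.
have m0z : m0 rzero = 0 by rewrite /m0; upds.
have m0b : m0 rbase = Negz 19 by rewrite /m0; upds.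
have m0c : m0 rcap = n.+1 by rewrite /m0; upds => /=; lia.
have m0o : m0 rown = 2 by rewrite /m0; upds.
have m0j : m0 rj = n by rewrite /m0; upds; rewrite addr0.
have bits (j : 'I_n) (i : 'I_k) : m0 (2 + (j * k + i))%N = (i \in C j).
  rewrite /m0; upds; rewrite /= ; congr (Posz (nat_of_bool _)).
  apply/existsP/idP => [[j' /existsP[i' /andP[/eqP]]]|ij]; last first.
    by exists j; apply/existsP; exists i; rewrite eqxx.
  rewrite add0n => e.
  have k_gt0 : (0 < k)%N by apply: leq_ltn_trans (ltn_ord i).
  (* Division by [k] recovers the row from the address, so each bit cell encodes one pair only. *)
  have ej : j = j'.
    apply: val_inj => /=; have := congr1 (divn^~ k) e.
    by rewrite /= !divnMDl // !divn_small // !addn0.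
  have -> : i = i' by apply: val_inj; move: e; rewrite ej => /addnI.
  by rewrite ej.
clearbody m0.
pose J d (m : memory) := m rown = (2 + (n - d) * k)%N /\
  (forall a, a != rown -> a != rj -> m a = m0 a).
apply: (@wp_for _ J _ _ n) => //.
- exact: ltnW.
- by split=> [|//]; rewrite subnn.
- by move=> i m [_ ->].
- move=> i m ltin mj [mo me]; instr; upds; split=> //; split; upds.
    rewrite mo me // m0k; have -> : (n - i = (n - i.+1).+1)%N by lia.
    by rewrite mulSn; lia.
  by move=> a /negPf ao /negPf aj; rewrite !upd_neq // me ?ao ?aj.
- move=> m mj [mo me]; split; rewrite ?mo ?me ?subn0 //.
  by move=> j i; rewrite me.
Qed.

(** Invariant of the descending loop of [scan]: the symbols seen so far are those from [d] on. At
    the cap [n.+1], nothing is claimed about [rbj]. *)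
Definition best (i : 'I_k) (p : 'I_n -> nat) (d : nat) (m : memory) :=
  exists b : nat, [/\ m rbp = b, (b <= n.+1)%N,
    forall j : 'I_n, (d <= j)%N -> i \in C j -> (b <= p j)%N &
    (b <= n)%N -> exists j : 'I_n, [/\ m rbj = j, i \in C j & p j = b]].

Lemma best_step i p (j : 'I_n) (m m' : memory) (d := val j) :
  best i p d.+1 m -> (i \notin C j \/ m rbp <= p j) ->
  m' rbp = m rbp -> m' rbj = m rbj -> best i p d m'.
Proof.
case=> b [mb leb minb exb] jb eb ej; exists b; split=> //; rewrite ?eb ?ej //.
move=> j' le_dj' ij'; have [ejj'|ne] := eqVneq j j'; last first.
  by apply: minb => //; rewrite ltn_neqAle le_dj' andbT.
by case: jb => [|]; rewrite ejj' ?ij' // mb.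
Qed.

Lemma best_better i p (j : 'I_n) (m m' : memory) (d := val j) :
  best i p d.+1 m -> i \in C j -> (p j)%:Z < m rbp ->
  m' rbp = p j -> m' rbj = j -> best i p d m'.
Proof.
case=> b [mb leb minb exb] ij; rewrite mb => pjb eb ej.
exists (p j); split=> //; first by lia.
  move=> j' le_dj' ij'; have [->//|ne] := eqVneq j j'.
  have := minb j' _ ij'; rewrite ltn_neqAle le_dj' andbT => /(_ ne); lia.
by exists j.
Qed.

Notation scan_regs := [:: rbp; rj; radr; rt1; rt2; rbj].

Lemma wp_scan p o m (i : 'I_k) :
  state p o m -> m rcur = i.+1 ->
  wp B scan m (fun m' => [/\ state p o m', frame scan_regs m m' & best i p 0 m']).
Proof.
move=> st cur; rewrite /scan; do 4 instr.
set m0 := upd _ _ _.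
pose J d m' := [/\ state p o m', frame scan_regs m m', best i p d m' &
  m' radr = (2 + (d * k + i))%N].
have bm := state_base st.
apply: (@wp_for _ J _ _ n); rewrite -/m0.
- exact: ltnW.
- by rewrite /m0; upds; rewrite base_n // base_zero // addr0.
- rewrite /m0; split; [by do ?apply: state_upd | by do ?apply: frame_upd | |].
    exists n.+1; split=> //; last by rewrite ltnn.
      by upds; rewrite base_cap // base_zero // addr0.
    by move=> j; rewrite leqNgt ltn_ord.
  by upds; rewrite base_own // cur base_one //; lia.
- by move=> d m' [/state_base/base_one].
- move=> d m1 ltdn m1j [st1 fr1 be1 adr1].
  pose j := Ordinal ltdn.
  do 2 instr; upds.
  have bm1 := state_base st1.
  have adr1' : m1 radr - m1 1 = (2 + (j * k + i))%N.
    by rewrite adr1 base_k //= mulSn; lia.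
  rewrite adr1'; set m2 := upd _ _ _.
  have st2 : state p o m2 by do ?apply: state_upd.
  have bm2 := state_base st2.
  have m2t : m2 rt1 = (i \in C j).
    by rewrite /m2 upd_eq; upds; rewrite (base_bit bm1).
  have m2j : m2 rj = j by rewrite /m2; upds.
  have fr2 : frame scan_regs m m2 by do ?apply: frame_upd.
  have adr2 : m2 radr = (2 + (d * k + i))%N by rewrite /m2; upds.
  have bp2 : m2 rbp = m1 rbp by rewrite /m2; upds.
  have bj2 : m2 rbj = m1 rbj by rewrite /m2; upds.
  clearbody m2.
  apply: wp_when; rewrite ?base_one // m2t; last first.
    move=> ij; split=> //; split=> //; apply: (best_step (j := j)) be1 _ bp2 bj2.
    by left; move: ij; case: (i \in C j).
  case ij: (i \in C j) => // _.
  do 3 instr; upds; rewrite base_base // m2j Negz_base upd_neq; last first.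
    by apply/eqP => -[].
  rewrite (state_price st2); set m3 := upd _ _ _.
  have st3 : state p o m3 by do ?apply: state_upd.
  have bm3 := state_base st3.
  have m3t1 : m3 rt1 = p j by rewrite /m3; upds.
  have m3t2 : m3 rt2 = m1 rbp - (p j)%:Z by rewrite /m3; upds; rewrite bp2.
  have m3j : m3 rj = j by rewrite /m3; upds.
  have fr3 : frame scan_regs m m3 by do ?apply: frame_upd.
  have adr3 : m3 radr = (2 + (d * k + i))%N by rewrite /m3; upds.
  have bp3 : m3 rbp = m1 rbp by rewrite /m3; upds.
  have bj3 : m3 rbj = m1 rbj by rewrite /m3; upds.
  clearbody m3.
  apply: wp_when; rewrite ?base_one // m3t2 ?subr_gt0 ?subr_le0 => lep; last first.
    split=> //; split=> //; apply: (best_step (j := j)) be1 _ bp3 bj3.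
    by right.
  do 2 instr; upds; split=> //; split; upds => //.
  + by do ?apply: state_upd.
  + by do ?apply: frame_upd.
  + apply: (best_better (j := j)) be1 ij lep _ _; upds.
      by rewrite m3t1 base_zero // addr0.
    by rewrite m3j base_zero // addr0.
- by move=> m' _ [].
Qed.

Lemma state_price_upd p o m (j : 'I_n) (v : nat) :
  state p o m -> state (fupd p j v) o (upd m (Negz (19 + j)) v).
Proof.
move=> [bm pm om]; split=> [|j'|j']; first exact: base_upd.
  rewrite /fupd; have [->|ne] := eqVneq j' j; first by rewrite upd_eq.
  rewrite upd_neq //; apply: contraNF ne => /eqP[e]; apply/eqP/val_inj => /=; lia.
by rewrite upd_neq.
Qed.

Lemma state_owner_upd p o m (j : 'I_n) (x : option 'I_k) :
  state p o m -> state p (fupd o j x) (upd m (2 + n * k + j)%N (enc x)).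
Proof.
move=> [bm pm om]; split=> [|j'|j'].
- by apply: base_upd => //=; rewrite leq_addr.
- by rewrite upd_neq.
- rewrite /fupd; have [->|ne] := eqVneq j' j; first by rewrite upd_eq.
  by rewrite upd_neq //; apply: contraNF ne => /eqP[/addnI/val_inj->].
Qed.

(** [x] counts the bids made and is the progress measure: while somebody waits, every bid so far has
    raised the sum of the prices by 1. *)
Definition bidding (i0 : 'I_k) (d x : nat) (m : memory) := exists p o cur,
  [/\ state p o m, m rcur = enc cur, auction_inv C i0 d p o cur &
    cur = None \/ (x <= \sum_j p j)%N].

Notation bid_regs := [:: rbp; rj; radr; rt1; rt2; rbj; rcur; rcnt].

Lemma wp_bid i0 d x m : bidding i0 d x m ->
  wp B bid m (fun m' => bidding i0 d x.+1 m' /\ frame bid_regs m m').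
Proof.
case=> p [o [cur [st mcur inv le_x]]]; rewrite /bid.
have bm := state_base st; apply: wp_when; rewrite ?base_one //; last first.
  case: cur mcur inv le_x => [i ->//|mcur inv _ _].
  by split=> //; exists p, o, None; split=> //; left.
case: cur mcur inv le_x => [i|->//] mcur inv [//|le_x] _.
apply/wp_seq/(wp_mono _ (wp_scan st mcur)) => m1 [st1 fr1 be1].
have m1cur : m1 rcur = i.+1 by rewrite fr1.
have {}fr1 : frame bid_regs m m1 by apply: frame_trans fr1.
case: be1 => b [m1b leb minb exb].
have bm1 := state_base st1.
do 3 instr; upds; rewrite (base_zero bm1) (base_cap bm1) m1b m1cur !addr0.
set m2 := upd _ _ _.
have st2 : state p o m2 by do ?apply: state_upd.
have fr2 : frame bid_regs m m2 by do ?apply: frame_upd.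
have m2cur : m2 rcur = 0 by rewrite /m2; upds.
have m2cnt : m2 rcnt = i.+1 by rewrite /m2; upds.
have m2t2 : m2 rt2 = n.+1%:Z - b%:Z by rewrite /m2; upds.
have m2b : m2 rbp = b by rewrite /m2; upds.
have m2j : m2 rbj = m1 rbj by rewrite /m2; upds.
clearbody m2.
have bm2 := state_base st2.
apply: wp_when; rewrite ?base_one // m2t2 => le_b; last first.
  split=> //; exists p, o, None; split=> //; last by left.
  by apply: auction_drop inv _ => j ij; have := minb j isT ij; lia.
have le_bn : (b <= n)%N by lia.
have [j [m1j ij pj]] := exb le_bn.
do 3 instr; upds; rewrite (base_base bm2) (base_one bm2) m2b m2j m1j Negz_base.
have -> : b%:Z + 1 = (p j).+1 by rewrite pj; lia.
set m3 := upd _ _ _.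
have st3 : state (fupd p j (p j).+1) o m3.
  by apply: state_price_upd; do ?apply: state_upd.
have fr3 : frame bid_regs m m3 by do ?apply: frame_upd.
have m3cnt : m3 rcnt = enc (Some i) by rewrite /m3; upds.
have m3j : m3 rbj = j by rewrite /m3; upds; rewrite m2j.
clearbody m3.
have bm3 := state_base st3.
do 3 instr; upds; rewrite (base_own bm3) m3j -PoszD upd_neq //.
upds; rewrite (state_owner st3) m3cnt.
split; last by do ?apply: frame_upd.
exists (fupd p j (p j).+1), (fupd o j (Some i)), (o j); split.
- by apply: state_owner_upd; do ?apply: state_upd.
- by upds.
- by apply: auction_bid => //; rewrite pj // => j' ij'; apply: minb.
- by rewrite sum_fupd_succ; right.
Qed.

Notation round_regs := [:: rbp; rj; radr; rt1; rt2; rbj; rcur; rcnt; rc1; rc2].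
Notation auction_regs :=
  [:: rbp; rj; radr; rt1; rt2; rbj; rcur; rcnt; rc1; rc2; ri].

Lemma bidding_upd i0 d x m a v :
  scratch a -> a != rcur -> bidding i0 d x m -> bidding i0 d x (upd m a v).
Proof.
move=> sa /negPf ne [p [o [cur [st mcur inv le_x]]]]; exists p, o, cur; split=> //.
  exact: state_upd.
by rewrite upd_neq // eq_sym.
Qed.

Lemma bidding_base i0 d x m : bidding i0 d x m -> base m.
Proof. by case=> p [o [cur [/state_base]]]. Qed.

Definition settled i0 d m :=
  exists p o, state p o m /\ auction_inv C i0 d p o None.

(* The sum of the prices grows with every bid that leaves a data symbol waiting
   and never exceeds n * n.+1, so n.+1 * n.+1 rounds suffice. *)
Lemma wp_rounds i0 d m : bidding i0 d 0 m ->
  wp B (IAdd rc1 rcap rzero ;; For rc1 (IAdd rc2 rcap rzero ;; For rc2 bid)) m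
    (fun m' => settled i0 d m' /\ frame round_regs m m').
Proof.
move=> bi; have bm := bidding_base bi.
instr; rewrite (base_cap bm) (base_zero bm) addr0; set m0 := upd _ _ _.
pose J c m' := [/\ frame round_regs m m' &
  exists2 x, (x + c * n.+1 = n.+1 * n.+1)%N & bidding i0 d x m'].
apply: (@wp_for _ J _ _ n.+1); rewrite -/m0 //.
- split; first by do ?apply: frame_upd.
  by exists 0%N => //; do ?apply: bidding_upd.
- by move=> c m' [_ [x _ /bidding_base/base_one]].
- move=> c m1 ltcn m1c [fr1 [x xE bi1]].
  have bm1 := bidding_base bi1.
  instr; upds; rewrite (base_cap bm1) (base_zero bm1) addr0.
  set m2 := upd _ _ _.
  pose J' c' (m' : memory) := [/\ m' rc1 = c, frame round_regs m m' &
    exists2 x, (x + c' + c * n.+1 = n.+1 * n.+1)%N & bidding i0 d x m'].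
  apply: (@wp_for _ J' _ _ n.+1); rewrite -/m2 //.
  + rewrite /m2; split; [by upds | by do ?apply: frame_upd |].
    by exists x; [move: xE; rewrite mulSn; lia | do ?apply: bidding_upd].
  + by move=> c' m' [_ _ [y _ /bidding_base/base_one]].
  + move=> c' m3 ltcn' m3c [m3c1 fr3 [y yE bi3]].
    have bi4 : bidding i0 d y (upd m3 rc2 c') by apply: bidding_upd.
    apply: wp_mono (wp_bid bi4) => m5 [bi5 fr5].
    split; first by rewrite fr5 // upd_eq.
    split; first by rewrite fr5 // upd_neq.
      by apply: frame_trans fr5 => //; apply: frame_upd.
    by exists y.+1 => //; lia.
  + move=> m3 _ [m3c fr3 [y yE bi3]]; split=> //; split=> //.
    by exists y => //; lia.
- move=> m1 _ [fr1 [x xE [p [o [cur [st mcur inv le_x]]]]]]; split=> //.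
  exists p, o; split=> //; case: le_x inv => [->//|].
  by move=> le_x /auction_sum_le; lia.
Qed.

Lemma wp_auction i0 m : settled i0 k m ->
  wp B auction m (fun m' => settled i0 0 m' /\ frame auction_regs m m').
Proof.
move=> [p [o [st inv]]]; have bm := state_base st.
rewrite /auction; instr; rewrite (base_k bm) (base_zero bm) addr0.
pose J d m' := settled i0 d m' /\ frame auction_regs m m'.
apply: (@wp_for _ J _ _ k) => //.
- split; last by do ?apply: frame_upd.
  by exists p, o; split=> //; do ?apply: state_upd.
- by move=> d m' [[p' [o' [/state_base/base_one]]]].
- move=> d m1 ltdk m1i [[p' [o' [st1 inv1]]] fr1].
  have bm1 := state_base st1.
  instr; upds; rewrite (base_one bm1).
  set m2 := upd _ _ _.
  have bi2 : bidding i0 d 0 m2.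
    exists p', o', (Some (Ordinal ltdk)); split; last by right.
    + by do ?apply: state_upd.
    + by rewrite /m2 upd_eq /=; lia.
    + exact: (auction_enter (i := Ordinal ltdk)).
  have m2i : m2 ri = d by rewrite /m2; upds.
  have fr2 : frame auction_regs m m2 by do ?apply: frame_upd.
  clearbody m2.
  apply: wp_mono (wp_rounds bi2) => m3 [se3 fr3].
  by split; [rewrite fr3 | split=> //; apply: frame_trans fr3].
Qed.

Notation reset_regs := [:: rj; radr; rt1; rt2].

Lemma wp_reset (i0 : 'I_k) m : base m -> m ri0 = i0 ->
  wp B reset m (fun m' => settled i0 k m' /\ frame reset_regs m m').
Proof.
move=> bm mi0; rewrite /reset; do 2 instr; upds.
rewrite (base_n bm) (base_zero bm) (base_own bm) mi0 addr0 -PoszD.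
pose p0 (j : 'I_n) : nat := if i0 \in C j then n.+1 else 0%N.
(* Below [d] the tables may still hold values left by the auction for another [i0]. *)
pose ready d (m' : memory) := forall j : 'I_n, (d <= j)%N ->
  m' (Negz (19 + j)) = p0 j /\ m' (2 + n * k + j)%N = 0.
pose J d m' := [/\ base m', frame reset_regs m m',
  m' radr = (2 + (d * k + i0))%N & ready d m'].
apply: (@wp_for _ J _ _ n) => //.
- exact: ltnW.
- split; [by do ?apply: base_upd | by do ?apply: frame_upd | |].
    by upds; rewrite addnA.
  by move=> j; rewrite leqNgt ltn_ord.
- by move=> d m' [/base_one].
- move=> d m1 ltdn m1j [bm1 fr1 adr1 rd1].
  pose j := Ordinal ltdn.
  do 4 instr; upds.
  rewrite (base_k bm1) (base_base bm1) (base_zero bm1) adr1 Negz_base.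
  have -> : Posz (2 + (d.+1 * k + i0)) - k%:Z = (2 + (j * k + i0))%N.
    by rewrite /= mulSn; lia.
  upds; rewrite (base_bit bm1); set m2 := upd _ _ _.
  have bm2 : base m2 by do ?apply: base_upd.
  have fr2 : frame reset_regs m m2 by do ?apply: frame_upd.
  have adr2 : m2 radr = (2 + (d * k + i0))%N by rewrite /m2; upds.
  have m2j : m2 rj = d by rewrite /m2; upds.
  have m2t1 : m2 rt1 = Negz (19 + j) by rewrite /m2; upds.
  have m2t2 : m2 rt2 = (i0 \in C j) by rewrite /m2; upds.
  have m2p : m2 (Negz (19 + j)) = 0 by rewrite /m2; upds.
  have ne_price (j' : 'I_n) : (d < j')%N -> (Negz (19 + j') == Negz (19 + j)) = false.
    by move=> ltdj; apply/eqP => -[] /=; lia.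
  have rd2 : ready d.+1 m2.
    move=> j' ltdj; have [pj oj] := rd1 _ ltdj.
    by rewrite -pj -oj /m2; split; do ?rewrite upd_neq ?ne_price.
  clearbody m2.
  (* Common postcondition of both outcomes of the test of the membership bit. *)
  pose mid (m' : memory) := [/\ base m', frame reset_regs m m',
    m' radr = (2 + (d * k + i0))%N, m' rj = d &
    m' (Negz (19 + j)) = p0 j /\ ready d.+1 m'].
  apply/wp_seq/(@wp_mono _ _ _ mid).
    move=> m3 [bm3 fr3 adr3 m3j [pj3 rd3]]; do 2 instr; upds.
    rewrite (base_own bm3) m3j -PoszD; upds; rewrite (base_zero bm3).
    split; first by upds.
    split; [ by do ?apply: base_upd; rewrite //= leq_addr
           | by do ?apply: frame_upd | by upds |].
    move=> j'; rewrite leq_eqVlt => /orP[/eqP/(@val_inj _ _ _ j)<-|ltdj].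
      by upds.
    have [pj' oj'] := rd3 _ ltdj; upds; split=> //.
    by rewrite upd_neq; [upds | apply/eqP => -[] /=; lia].
  apply: wp_when; rewrite ?base_one // m2t2.
    move=> ij; instr; rewrite m2t1 (base_cap bm2).
    split; [by do ?apply: base_upd | by do ?apply: frame_upd | by upds | by upds |].
    split; first by rewrite upd_eq /p0; move: ij; case: (i0 \in C j).
    move=> j' ltdj; have [pj' oj'] := rd2 _ ltdj.
    by rewrite !upd_neq ?ne_price.
  move=> ij; split=> //; split=> //.
  by rewrite m2p /p0; move: ij; case: (i0 \in C j).
- move=> m' _ [bm' fr' _ rd]; split=> //; exists p0, (fun _ => None).
  split; last exact: auction_init.
  by split=> // j; have [] := rd j isT.
Qed.

Lemma wp_tally p o m : state p o m ->
  wp B tally m (fun m' => [/\ state p o m', frame [:: rcnt; rj; rt1] m m' &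
    m' rcnt = #|[set j | (0 < p j)%N]|]).
Proof.
move=> st; have bm := state_base st; rewrite /tally; do 2 instr; upds.
rewrite (base_n bm) (base_zero bm) !addr0.
pose S d := [set j : 'I_n | (d <= j)%N && (0 < p j)%N].
pose J d (m' : memory) := [/\ state p o m', frame [:: rcnt; rj; rt1] m m' &
  m' rcnt = #|S d|].
apply: (@wp_for _ J _ _ n) => //.
- exact: ltnW.
- split; [by do ?apply: state_upd | by do ?apply: frame_upd | upds].
  suff -> : S n = set0 by rewrite cards0.
  by apply/setP => j; rewrite !inE leqNgt ltn_ord.
- by move=> d m' [/state_base/base_one].
- move=> d m1 ltdn m1j [st1 fr1 cnt1].
  pose j := Ordinal ltdn; have bm1 := state_base st1.
  do 2 instr; upds; rewrite (base_base bm1) Negz_base upd_neq //.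
  upds; rewrite (state_price st1 j); set m2 := upd _ _ _.
  have st2 : state p o m2 by do ?apply: state_upd.
  have fr2 : frame [:: rcnt; rj; rt1] m m2 by do ?apply: frame_upd.
  have m2j : m2 rj = d by rewrite /m2; upds.
  have m2c : m2 rcnt = #|S d.+1| by rewrite /m2; upds.
  have m2t : m2 rt1 = p j by rewrite /m2; upds.
  clearbody m2.
  have bm2 := state_base st2.
  have SE : #|S d| = ((0 < p j) + #|S d.+1|)%N.
    rewrite (cardsD1 j) inE leqnn; congr (_ + #|pred_of_set _|)%N.
    apply/setP => j'; rewrite !inE andbA; congr (_ && _).
    by rewrite [RHS]ltn_neqAle eq_sym.
  apply: wp_when; rewrite ?base_one // m2t => pj.
    instr; upds; rewrite m2c (base_one bm2); split=> //.
    split; [by do ?apply: state_upd | by do ?apply: frame_upd |].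
    by upds; rewrite SE; lia.
  split=> //; split=> //; rewrite m2c SE; lia.
Qed.

Lemma wp_dmax_prog : (0 < k)%N ->
  wp B dmax_prog (input C) (fun m' => m' 0 = dmax C).
Proof.
move=> k_gt0; rewrite /dmax_prog; apply/wp_seq/(wp_mono _ wp_setup) => m bm.
do 2 instr; upds; rewrite (base_n bm) (base_zero bm) (base_k bm) !addr0.
(* [v - k] is the minimum excess over the sets treated so far, those with an element at least [d],
   together with the initial candidate; at [d = 0] every nonempty set is covered. *)
pose J d m' := base m' /\ exists v : nat, [/\ m' rres = v,
  exists2 I : {set 'I_k}, I != set0 & excess C I <= v%:Z - k%:Z &
  forall (I : {set 'I_k}) (i : 'I_k), i \in I -> (d <= i)%N ->
    v%:Z - k%:Z <= excess C I].
apply/wp_seq/(@wp_for _ J _ _ k) => //.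
- split; first by do ?apply: base_upd.
  exists n; split; first by upds.
    (* The full set has excess at most [n - k], which justifies the initial value [n]. *)
    exists [set: 'I_k].
      by apply/set0Pn; exists (Ordinal k_gt0); rewrite inE.
    rewrite /excess cardsT card_ord lerD2r lez_nat.
    by apply: leq_trans (max_card _) _; rewrite card_ord.
  by move=> I i _; rewrite leqNgt ltn_ord.
- by move=> d m' [/base_one].
- move=> d m1 ltdk m1i [bm1 [v [m1v [I I_neq0 leI] lev]]].
  pose i0 := Ordinal ltdk.
  set m2 := upd _ _ _.
  have bm2 : base m2 by apply: base_upd.
  have m2i : m2 ri0 = i0 by rewrite /m2; upds.
  have m2v : m2 rres = v by rewrite /m2; upds.
  clearbody m2.
  apply/wp_seq/(wp_mono _ (wp_reset bm2 m2i)) => m3 [se3 fr3].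
  apply/wp_seq/(wp_mono _ (wp_auction se3)) => m4 [[p [o [st4 inv4]]] fr4].
  apply/wp_seq/(wp_mono _ (wp_tally st4)) => m5 [st5 fr5 cnt5].
  have bm5 := state_base st5.
  have m5i : m5 ri0 = d by rewrite fr5 // fr4 // fr3.
  have m5v : m5 rres = v by rewrite fr5 // fr4 // fr3.
  have [I' i0I' leI'] := excess_upper inv4.
  have leI'' := excess_lower inv4.
  move: #|_| cnt5 leI' leI'' => c cnt5 leI' leI''.
  (* An element at least [d] is either [i0], handled by the current auction, or larger, handled by
     the invariant. *)
  have split_d (I1 : {set 'I_k}) (i : 'I_k) (w : int) :
      w <= v%:Z - k%:Z -> w <= c%:Z - k%:Z -> i \in I1 -> (d <= i)%N ->
      w <= excess C I1.
    move=> lewv lewc iI1; rewrite leq_eqVlt => /orP[/eqP di|ltdi].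
      apply: le_trans lewc _; apply: leI''.
      by rewrite (_ : i0 = i) //; apply: val_inj.
    apply: le_trans lewv _; exact: lev ltdi.
  instr; rewrite m5v cnt5; set m6 := upd _ _ _.
  have bm6 : base m6 by apply: base_upd.
  apply: wp_when; rewrite ?base_one // /m6 upd_eq => lec.
    instr; upds; split=> //.
    split; first by do ?apply: base_upd.
    exists c; split; first by upds; rewrite cnt5 (base_zero bm5) addr0.
      by exists I' => //; apply/set0Pn; exists i0.
    by move=> I1 i iI1; apply: split_d iI1; lia.
  split; first by upds.
  split=> //; exists v; split; first by upds.
    by exists I.
  by move=> I1 i iI1; apply: split_d iI1; lia.
- move=> m1 _ [bm1 [v [m1v exI lev]]].
  do 2 instr; upds; rewrite m1v (base_one bm1) (base_k bm1).
  rewrite (dmax_eq exI); first by lia.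
  by move=> I /set0Pn[i iI]; apply: lev iI _.
Qed.

End Program.

(** * The time bound as a polynomial in [n] and [k] *)

Theorem proposition1 :
  exists (P : seq instr) (p : {poly {poly nat}}),
    forall (n k : nat) (C : 'I_n -> {set 'I_k}),
      (0 < n)%N -> (0 < k)%N ->
      outputs_within P (input C) p.[n%:P].[k] (dmax C).
Proof.
(* The outer variable stands for [n] and the inner one for [k], so the loop bound evaluates to
   [n + k + 1]. This covers all loops, whose lengths are [n], [n.+1] and [k]. *)
exists (compile dmax_prog 0), (cost ('X + 'X%:P + 1) dmax_prog) => n k C _ k_gt0.
rewrite !horner_cost !hornerE.
by apply/outputs_within_wp/wp_dmax_prog => //; lia.
Qed.
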